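(* Let $G$ be a computable subgroup of $S_\infty$. If $G$ has only finitely many actions, then $R^{ce}_G\equiv_c\,=^{ce}$.
   Context: $(W_e)_{e\in\omega}$ is a standard uniform enumeration of the c.e.\ subsets of $\omega$; $i=^{ce}j\iff W_i=W_j$. A computable subgroup of $S_\infty$ is a computable group acting computably by permutations on $\omega$; it has only finitely many actions if the set of permutations of $\omega$ induced by its elements is finite. $i\,R^{ce}_G\,j\iff(\exists\gamma\in G)(W_i=\{\gamma(x):x\in W_j\})$. $E\le_c F$ means there is a computable $f$ with $x\,E\,y\iff f(x)\,F\,f(y)$; $E\equiv_c F$ means $E\le_c F$ and $F\le_c E$. *)

(* Defs.v *)
From Stdlib Require Cantor.
From mathcomp Require Import all_boot all_classical zify.

Set Implicit Arguments.
Unset Strict Implicit.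
Unset Printing Implicit Defensive.

Local Open Scope classical_set_scope.

Definition npair (x y : nat) : nat := Cantor.to_nat (x, y).
Definition nfst (n : nat) : nat := (Cantor.of_nat n).1.
Definition nsnd (n : nat) : nat := (Cantor.of_nat n).2.

(* Programs for the partial recursive functions; several arguments are
   passed as one number through the Cantor pairing. *)
Inductive code : Type :=
| CZero
| CSucc
| CFst
| CSnd
| CPair of code & code
| CComp of code & code
| CPrec of code & code
| CMu of code.

(* Graph of h (a, 0) = f a, h (a, k+1) = g (a, (k, h (a, k))), for partial
   functions f and g given by their graphs F and G. *)
Fixpoint prec_graph (F G : nat -> nat -> Prop) (a k m : nat) : Prop :=
  if k is k'.+1 then
    exists2 r, prec_graph F G a k' r & G (npair a (npair k' r)) m
  else F a m.

(* eval c n m: program c halts on input n with output m. In the CMu case, m is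
   the least zero of k |-> f (n, k), all earlier values being defined. *)
Fixpoint eval (c : code) (n m : nat) : Prop :=
  match c with
  | CZero => m = 0
  | CSucc => m = n.+1
  | CFst => m = nfst n
  | CSnd => m = nsnd n
  | CPair f g => exists a b, [/\ eval f n a, eval g n b & m = npair a b]
  | CComp f g => exists2 a, eval g n a & eval f a m
  | CPrec f g => prec_graph (eval f) (eval g) (nfst n) (nsnd n) m
  | CMu f => eval f (npair n m) 0 /\
             forall k, k < m -> exists y, eval f (npair n k) y.+1
  end.

Lemma eval_functional c n m1 m2 : eval c n m1 -> eval c n m2 -> m1 = m2.
Proof.
elim: c n m1 m2 => /= [||||f IHf g IHg|f IHf g IHg|f IHf g IHg|f IHf] n m1 m2.
1-4: by move=> -> ->.
- move=> [a1 [b1 [fa1 gb1 ->]]] [a2 [b2 [fa2 gb2 ->]]].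
  by rewrite (IHf _ _ _ fa1 fa2) (IHg _ _ _ gb1 gb2).
- move=> [a1 ga1 fm1] [a2 ga2 fm2]; rewrite (IHg _ _ _ ga1 ga2) in fm1.
  exact: IHf fm1 fm2.
- elim: (nsnd n) m1 m2 => [|k IHk] m1 m2 /=; first exact: IHf.
  move=> [r1 hr1 gm1] [r2 hr2 gm2]; rewrite (IHk _ _ hr1 hr2) in gm1.
  exact: IHg gm1 gm2.
- move=> [f1 lt1] [f2 lt2].
  case: (ltngtP m1 m2) => // [/lt2|/lt1] [y fy].
    by have := IHf _ _ _ fy f1.
  by have := IHf _ _ _ fy f2.
Qed.

Definition computable (f : nat -> nat) : Prop :=
  exists c, forall n, eval c n (f n).

Definition computable2 (f : nat -> nat -> nat) : Prop :=
  computable (fun n => f (nfst n) (nsnd n)).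

Definition computable_pred (D : pred nat) : Prop :=
  computable (fun n => nat_of_bool (D n)).

Fixpoint encode (c : code) : nat :=
  match c with
  | CZero => 0
  | CSucc => 1
  | CFst => 2
  | CSnd => 3
  | CPair f g => 4 + (4 * npair (encode f) (encode g))
  | CComp f g => 4 + (4 * npair (encode f) (encode g) + 1)
  | CPrec f g => 4 + (4 * npair (encode f) (encode g) + 2)
  | CMu f => 4 + (4 * encode f + 3)
  end.

Lemma npair_inj a b a' b' : npair a b = npair a' b' -> a = a' /\ b = b'.
Proof.
move=> /(congr1 Cantor.of_nat); rewrite /npair !Cantor.cancel_of_to.
by case=> -> ->.
Qed.

Lemma encode_inj : injective encode.
Proof.
elim=> [||||f IHf g IHg|f IHf g IHg|f IHf g IHg|f IHf];
  case=> [||||f' g'|f' g'|f' g'|f'] //=; try lia;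
  try by move=> e; have /npair_inj[/IHf-> /IHg->] :
    npair (encode f) (encode g) = npair (encode f') (encode g') by lia.
by move=> e; rewrite (IHf f') //; lia.
Qed.

Lemma encode_surj e : exists c, encode c = e.
Proof.
elim/ltn_ind: e => e IH.
case: e IH => [|[|[|[|e]]]] IH;
  [by exists CZero | by exists CSucc | by exists CFst | by exists CSnd |].
have He := divn_eq e 4.
have lt4 : e %% 4 < 4 by rewrite ltn_mod.
have [a [b Hab]] : exists a b, npair a b = e %/ 4.
  exists (nfst (e %/ 4)), (nsnd (e %/ 4)).
  by rewrite /npair /nfst /nsnd -surjective_pairing Cantor.cancel_to_of.
have Hle : a + b <= npair a b.
  by apply/leP; rewrite addnC; exact: Cantor.to_nat_non_decreasing.
have [f Hf] : exists f, encode f = a by apply: IH; lia.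
have [g Hg] : exists g, encode g = b by apply: IH; lia.
have [h Hh] : exists h, encode h = e %/ 4 by apply: IH; lia.
have [r0|[r1|[r2|r3]]] :
  e %% 4 = 0 \/ e %% 4 = 1 \/ e %% 4 = 2 \/ e %% 4 = 3 by lia.
- by exists (CPair f g); rewrite /= Hf Hg Hab; lia.
- by exists (CComp f g); rewrite /= Hf Hg Hab; lia.
- by exists (CPrec f g); rewrite /= Hf Hg Hab; lia.
- by exists (CMu h); rewrite /= Hh; lia.
Qed.

(* W e is the domain of the partial recursive function with index e. *)
Definition W (e : nat) : set nat :=
  [set x | exists c, encode c = e /\ exists y, eval c x y].

(* A group whose universe is a computable subset of nat and whose operations
   are computable. The operations are total on nat, but only their values on
   the universe matter. *)
Record computable_group : Type := ComputableGroup {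
  gdom : pred nat;
  gone : nat;
  gmul : nat -> nat -> nat;
  ginv : nat -> nat;
  gdom_computable : computable_pred gdom;
  gmul_computable : computable2 gmul;
  ginv_computable : computable ginv;
  gdom_one : gdom gone;
  gdom_mul : forall g h, gdom g -> gdom h -> gdom (gmul g h);
  gdom_inv : forall g, gdom g -> gdom (ginv g);
  gmulA : forall g h k, gdom g -> gdom h -> gdom k ->
    gmul g (gmul h k) = gmul (gmul g h) k;
  gmul1 : forall g, gdom g -> gmul gone g = g;
  gmulV : forall g, gdom g -> gmul (ginv g) g = gone
}.

(* A computable group with a computable, not necessarily faithful, action on
   nat; the action axioms make each gact g, for g in the group, a permutation
   of nat. *)
Record computable_subgroup_Sinf : Type := ComputableSubgroupSinf {
  sgroup :> computable_group;
  gact : nat -> nat -> nat;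
  gact_computable : computable2 gact;
  gact1 : forall x, gact (gone sgroup) x = x;
  gactM : forall g h x, gdom sgroup g -> gdom sgroup h ->
    gact (gmul sgroup g h) x = gact g (gact h x)
}.

Definition finitely_many_actions (G : computable_subgroup_Sinf) : Prop :=
  finite_set (gact G @` [set g | gdom G g]).

Definition eq_ce (i j : nat) : Prop := W i = W j.

Definition R_ce (G : computable_subgroup_Sinf) (i j : nat) : Prop :=
  exists2 g, gdom G g & W i = gact G g @` W j.

Definition creducible (E F : nat -> nat -> Prop) : Prop :=
  exists2 f, computable f & forall x y, E x y <-> F (f x) (f y).

Definition cequivalent (E F : nat -> nat -> Prop) : Prop :=
  creducible E F /\ creducible F E.

(* Main.v *)
(** Let s be a finite list of group elements inducing all the permutations.

    R_ce G reduces to eq_ce: send A to the c.e. set of all (size s)-tuples that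
    some element of G carries into A. If A and B give the same tuples, then some
    g maps A into B and some h maps B into A, since otherwise one counterexample
    per permutation would form a separating tuple. As h g has finite order on
    nat, the inclusion h g A <= A is an equality, so A = h B. The union over s
    has to be computed uniformly in the index of A; this is the only place where
    programs have to be run in parallel, and it is done by translating a program
    into a total one that takes a clock as additional argument.

    eq_ce reduces to R_ce G: all orbits are finite, so they can be numbered by
    their minima. The preimage of A under this numbering is G-invariant, and the
    numbering is onto nat, so A can be recovered from the preimage. *)

Require Import Defs.
From mathcomp Require Import all_boot all_classical zify.
From Stdlib Require Cantor.

Set Implicit Arguments.
Unset Strict Implicit.
Unset Printing Implicit Defensive.

Local Open Scope classical_set_scope.

(** * Projections and growth of the Cantor pairing *)

Lemma nfst_npair a b : nfst (npair a b) = a.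
Proof. by rewrite /nfst /npair Cantor.cancel_of_to. Qed.

Lemma nsnd_npair a b : nsnd (npair a b) = b.
Proof. by rewrite /nsnd /npair Cantor.cancel_of_to. Qed.

Lemma npair_eta n : npair (nfst n) (nsnd n) = n.
Proof. by rewrite /npair /nfst /nsnd -surjective_pairing Cantor.cancel_to_of. Qed.

Lemma npair_ge a b : a + b <= npair a b.
Proof. by apply/leP; rewrite addnC; exact: Cantor.to_nat_non_decreasing. Qed.

Definition npairE := (nfst_npair, nsnd_npair, npair_eta).

(** * Closure properties of computable functions *)

Lemma computable_ext f g : f =1 g -> computable f -> computable g.
Proof. by move=> fg [c cf]; exists c => n; rewrite -fg. Qed.

Lemma computable_comp f g :
  computable f -> computable g -> computable (fun n => f (g n)).
Proof. by move=> [c cf] [d dg]; exists (CComp c d) => n; exists (g n). Qed.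

Lemma computable_npair f g :
  computable f -> computable g -> computable (fun n => npair (f n) (g n)).
Proof.
by move=> [c cf] [d dg]; exists (CPair c d) => n; exists (f n), (g n).
Qed.

Lemma computable_nfst f : computable f -> computable (fun n => nfst (f n)).
Proof. by apply: (@computable_comp nfst); exists CFst. Qed.

Lemma computable_nsnd f : computable f -> computable (fun n => nsnd (f n)).
Proof. by apply: (@computable_comp nsnd); exists CSnd. Qed.

Lemma computable_succ f : computable f -> computable (fun n => (f n).+1).
Proof. by apply: (@computable_comp succn); exists CSucc. Qed.

(** The identity is not a basic program; it is the pairing of the two projections. *)
Lemma computable_id : computable id.
Proof.
apply: computable_ext (computable_npair _ _) => [n||].
- exact: npair_eta.
- by exists CFst.
- by exists CSnd.
Qed.

Lemma computable_const k : computable (fun=> k).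
Proof. by elim: k => [|k IH]; [exists CZero | exact: computable_succ]. Qed.

Lemma computable2_app h f g : computable2 h ->
  computable f -> computable g -> computable (fun n => h (f n) (g n)).
Proof.
move=> ch cf cg; apply: computable_ext (computable_comp ch (computable_npair cf cg)).
by move=> n; rewrite !npairE.
Qed.

Lemma computable2_prec f g h : computable f -> computable g ->
  (forall a, h a 0 = f a) ->
  (forall a k, h a k.+1 = g (npair a (npair k (h a k)))) -> computable2 h.
Proof.
move=> [c cf] [d dg] h0 hS; exists (CPrec c d) => n /=.
elim: (nsnd n) => [|k IH] /=; first by rewrite h0.
by exists (h (nfst n) k); rewrite // hS.
Qed.

(** A case distinction is a primitive recursion on the scrutinee that ignores its recursive
    value. *)
Lemma computable_case f g h : computable f -> computable g -> computable h ->
  computable (fun n => if f n is k.+1 then g (npair n k) else h n).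
Proof.
move=> cf cg ch.
apply: (@computable2_app (fun n m => if m is k.+1 then g (npair n k) else h n)
          id) => //; last exact: computable_id.
apply: (@computable2_prec _ (fun n => g (npair (nfst n) (nfst (nsnd n)))) _ ch)
  => [|//|a k]; last by rewrite !npairE.
apply: (computable_comp cg); apply: computable_npair.
  exact/computable_nfst/computable_id.
exact/computable_nfst/computable_nsnd/computable_id.
Qed.

Lemma computable_if f g h : computable f -> computable g -> computable h ->
  computable (fun n => if f n is _.+1 then g n else h n).
Proof.
move=> cf cg ch.
have cg' := computable_comp cg (computable_nfst computable_id).
apply: computable_ext (computable_case cf cg' ch) => n.
by case: (f n) => // k; rewrite nfst_npair.
Qed.

Lemma computable_predn f : computable f -> computable (fun n => (f n).-1).
Proof.
move=> cf.
have := computable_case cf (computable_nsnd computable_id) (computable_const 0).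
by apply: computable_ext => n; case: (f n) => //= k; rewrite nsnd_npair.
Qed.

(* The patterns are matched syntactically: unification would unfold npair into
   arithmetic. *)
Ltac computable_step :=
  lazymatch goal with
  | |- computable (fun _ => ?k) => exact: computable_const
  | |- computable nfst => exact: computable_nfst computable_id
  | |- computable nsnd => exact: computable_nsnd computable_id
  | |- computable id => exact: computable_id
  | |- computable (fun n => n) => exact: computable_id
  | |- computable (fun n => npair (@?f n) (@?g n)) =>
      apply: (@computable_npair f g)
  | |- computable (fun n => nfst (@?f n)) => apply: (@computable_nfst f)
  | |- computable (fun n => nsnd (@?f n)) => apply: (@computable_nsnd f)
  | |- computable (fun n => (@?f n).+1) => apply: (@computable_succ f)
  | |- computable (fun n => (@?f n).-1) => apply: (@computable_predn f)
  | _ => apply: computable_if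
  end.

Ltac solve_computable := repeat first [assumption | computable_step].

Lemma computable_add f g :
  computable f -> computable g -> computable (fun n => f n + g n).
Proof.
apply: computable2_app; apply: (@computable2_prec id (fun n => (nsnd (nsnd n)).+1)).
- by solve_computable.
- by solve_computable.
- exact: addn0.
- by move=> a k; rewrite !npairE addnS.
Qed.

Lemma computable_sub f g :
  computable f -> computable g -> computable (fun n => f n - g n).
Proof.
apply: computable2_app; apply: (@computable2_prec id (fun n => (nsnd (nsnd n)).-1)).
- by solve_computable.
- by solve_computable.
- exact: subn0.
- by move=> a k; rewrite !npairE subnS.
Qed.

Lemma computable_mul4 f : computable f -> computable (fun n => 4 * f n).
Proof.
move=> cf; apply: (@computable_ext (fun n => f n + f n + (f n + f n))).
  by move=> n; lia.
by do !apply: computable_add.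
Qed.

Lemma computable_minn f g :
  computable f -> computable g -> computable (fun n => minn (f n) (g n)).
Proof.
move=> cf cg; apply: (@computable_ext (fun n => f n - (f n - g n))).
  by move=> n; lia.
by do !apply: computable_sub.
Qed.

Lemma computable_prec1 f a g :
  computable g -> f 0 = a -> (forall k, f k.+1 = g (npair k (f k))) ->
  computable f.
Proof.
move=> cg f0 fS.
apply: (@computable2_app (fun _ => f) id id); try exact: computable_id.
apply: (@computable2_prec (fun=> a) (fun n => g (nsnd n))) => //.
- exact: computable_const.
- by apply: (computable_comp cg); solve_computable.
- by move=> b k; rewrite !npairE.
Qed.

(** The remainder is a counter reset after 3: the truncated difference [3 - r] is positive exactly
    when r < 3. The quotient by 4 grows at the resets. *)
Lemma computable_modn4 f : computable f -> computable (fun n => f n %% 4).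
Proof.
apply: (@computable_comp (modn^~ 4)).
apply: (@computable_prec1 _ 0
  (fun n => if 3 - nsnd n is _.+1 then (nsnd n).+1 else 0)) => [|//|k].
  apply: computable_if; solve_computable.
  by apply: computable_sub; solve_computable.
by rewrite !npairE; case E: (3 - _); lia.
Qed.

Lemma computable_divn4 f : computable f -> computable (fun n => f n %/ 4).
Proof.
apply: (@computable_comp (divn^~ 4)).
apply: (@computable_prec1 _ 0
  (fun n => if 3 - nfst n %% 4 is _.+1 then nsnd n else (nsnd n).+1)) => [|//|k].
  apply: computable_if; solve_computable.
  apply: computable_sub; solve_computable.
  by apply: computable_modn4; solve_computable.
by rewrite !npairE; case E: (3 - _); lia.
Qed.

Lemma computable_iter_nsnd f g : computable f -> computable g ->
  computable (fun n => iter (f n) nsnd (g n)).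
Proof.
move=> cf cg; apply: (@computable2_app (fun a k => iter k nsnd a) g f) => //.
apply: (@computable2_prec id (fun n => nsnd (nsnd (nsnd n)))) => //.
- exact: computable_id.
- by solve_computable.
- by move=> a k; rewrite !npairE.
Qed.

Ltac arith_step :=
  lazymatch goal with
  | |- computable (fun n => 4 * @?f n) => apply: (@computable_mul4 f)
  | |- computable (fun n => @?f n + @?g n) => apply: (@computable_add f g)
  | |- computable (fun n => @?f n - @?g n) => apply: (@computable_sub f g)
  | |- computable (fun n => @?f n %% 4) => apply: (@computable_modn4 f)
  | |- computable (fun n => @?f n %/ 4) => apply: (@computable_divn4 f)
  | |- computable (fun n => iter (@?f n) nsnd (@?g n)) =>
      apply: (@computable_iter_nsnd f g)
  | _ => computable_step
  end.

Ltac solve_arith := repeat first [assumption | arith_step].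

(** * Course-of-values recursion *)

(** All earlier values are stacked in one number with the latest on top, whence the [(n - k).-1]
    tails taken in [recall]. *)
Fixpoint history (f : nat -> nat) (n : nat) : nat :=
  if n is k.+1 then npair (f k) (history f k) else 0.

Definition recall (h n k : nat) : nat := nfst (iter (n - k).-1 nsnd h).

Lemma recall_history f n k : k < n -> recall (history f n) n k = f k.
Proof.
move=> lt_kn; rewrite /recall.
have -> : n = (n - k).-1 + k.+1 by lia.
move: (n - k).-1 => d; have -> : (d + k.+1 - k).-1 = d by lia.
by elim: d => [|d IH]; rewrite ?addSn ?iterSr /= ?nsnd_npair ?nfst_npair.
Qed.

Lemma computable_course_of_values f g : computable g ->
  (forall n, f n = g (npair n (history f n))) -> computable f.
Proof.
move=> cg fE; have ch : computable (history f).
  apply: (@computable_prec1 _ 0 (fun n => npair (g n) (nsnd n))) => // [|k /=].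
    by solve_computable.
  by rewrite !npairE -fE.
apply: (@computable_ext (fun n => g (npair n (history f n)))) => //.
by apply: (computable_comp cg); solve_computable.
Qed.

(** * Clocked evaluation *)

(* The states of the search are 0 while every value tried so far was a
   successor, 1 once an undefined value was met, and k + 2 once k was found. *)
Fixpoint bounded_search (v : nat -> nat) (j : nat) : nat :=
  if j is i.+1 then
    if bounded_search v i is 0 then
      match v i with 0 => 1 | 1 => i.+2 | _ => 0 end
    else bounded_search v i
  else 0.

(* Running c on n with every unbounded search cut off after s candidates: the
   result is 0 for failure and m + 1 for the output m. *)
Fixpoint clocked_eval (c : code) (n s : nat) : nat :=
  match c with
  | CZero => 1
  | CSucc => n.+2
  | CFst => (nfst n).+1
  | CSnd => (nsnd n).+1
  | CPair f g =>
      if clocked_eval f n s is a.+1 then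
        if clocked_eval g n s is b.+1 then (npair a b).+1 else 0
      else 0
  | CComp f g => if clocked_eval g n s is a.+1 then clocked_eval f a s else 0
  | CPrec f g =>
      nat_rect (fun=> nat) (clocked_eval f (nfst n) s)
        (fun k r => if r is r'.+1
           then clocked_eval g (npair (nfst n) (npair k r')) s else 0) (nsnd n)
  | CMu f => (bounded_search (fun k => clocked_eval f (npair n k) s) s).-1
  end.

(** Clocked values are shifted by one: [1 < v k] stands for a nonzero output at k, and [v m = 1] for
    the output 0 at m. *)
Lemma bounded_search_running v j :
  bounded_search v j = 0 -> forall k, k < j -> 1 < v k.
Proof.
elim: j => //= j IH.
case E: (bounded_search v j) => [|i] //.
case Ev: (v j) => [|[|y]] // _ k; rewrite ltnS leq_eqVlt => /orP[/eqP->|].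
  by rewrite Ev.
exact: IH.
Qed.

Lemma bounded_search_found v j m : bounded_search v j = m.+2 ->
  v m = 1 /\ forall k, k < m -> 1 < v k.
Proof.
elim: j => //= j IH; case E: (bounded_search v j) => [|i]; last by rewrite -E.
case Ev: (v j) => [|[|y]] // [<-]; split=> //; exact: bounded_search_running.
Qed.

Lemma bounded_search_complete v j m : v m = 1 -> (forall k, k < m -> 1 < v k) ->
  m < j -> bounded_search v j = m.+2.
Proof.
move=> vm lt_v; elim: j => //= j IH; rewrite ltnS leq_eqVlt.
case/orP=> [/eqP<-|/IH-> //].
have -> : bounded_search v m = 0.
  elim: {-2}m (leqnn m) => //= i IHi lt_im.
  by rewrite IHi ?(ltnW lt_im) //; case: (v i) (lt_v _ lt_im) => [|[]].
by rewrite vm.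
Qed.

Lemma clocked_eval_sound c n s m : clocked_eval c n s = m.+1 -> eval c n m.
Proof.
elim: c n m => /= [||||f IHf g IHg|f IHf g IHg|f IHf g IHg|f IHf] n m.
1-4: by case.
- case Ef: (clocked_eval f n s) => [|a] //.
  case Eg: (clocked_eval g n s) => [|b] // [<-].
  by exists a, b; split=> //; [apply: IHf | apply: IHg].
- case Eg: (clocked_eval g n s) => [|a] // Ef.
  by exists a; [apply: IHg | apply: IHf].
- elim: (nsnd n) m => [|k IHk] m /=; first exact: IHf.
  case Ek: (nat_rect _ _ _ k) => [|r] // Eg.
  by exists r; [apply: IHk | apply: IHg].
(* The predecessor sends both unsuccessful states 0 and 1 to 0, so the result m + 1 can only come
   from the state m + 2. *)
- move=> E; have /bounded_search_found[fm ltm] :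
    bounded_search (fun k => clocked_eval f (npair n k) s) s = m.+2.
    by move: E; case: bounded_search => //= k ->.
  split=> [|k /ltm]; first exact: IHf.
  case Ek: (clocked_eval f _ s) => [|[|y]] // _.
  by exists y; apply: IHf.
Qed.

(** Supplies a single clock for all the candidates that an unbounded search passes over. *)
Lemma eventually_bounded_forall (P : nat -> nat -> Prop) m :
  (forall k, k < m -> exists s0, forall s, s0 <= s -> P k s) ->
  exists s0, forall s, s0 <= s -> forall k, k < m -> P k s.
Proof.
elim: m => [|m IH] Pm; first by exists 0.
have [k lt_km|s1 P1] := IH; first by apply: Pm; lia.
have [s2 P2] := Pm m (ltnSn m).
exists (maxn s1 s2) => s; rewrite geq_max => /andP[le1 le2] k.
by rewrite ltnS leq_eqVlt => /orP[/eqP->|]; [apply: P2 | apply: P1].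
Qed.

(** Success is claimed for all large clocks at once, so that the clocks of subcomputations combine
    by maximum. *)
Lemma clocked_eval_complete c n m : eval c n m ->
  exists s0, forall s, s0 <= s -> clocked_eval c n s = m.+1.
Proof.
elim: c n m => /= [||||f IHf g IHg|f IHf g IHg|f IHf g IHg|f IHf] n m.
1-4: by move=> ->; exists 0.
- move=> [a [b [/IHf[s1 E1] /IHg[s2 E2] ->]]]; exists (maxn s1 s2) => s.
  by rewrite geq_max => /andP[le1 le2]; rewrite E1 ?E2.
- move=> [a /IHg[s1 E1] /IHf[s2 E2]]; exists (maxn s1 s2) => s.
  by rewrite geq_max => /andP[le1 le2]; rewrite E1 ?E2.
- elim: (nsnd n) m => [|k IHk] m /=; first exact: IHf.
  move=> [r /IHk[s1 E1] /IHg[s2 E2]]; exists (maxn s1 s2) => s.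
  by rewrite geq_max => /andP[le1 le2]; rewrite E1 ?E2.
- move=> [/IHf[s1 E1] ltm].
  have [k /ltm[y /IHf[s0 E0]]|s2 E2] := @eventually_bounded_forall
      (fun k s => 1 < clocked_eval f (npair n k) s) m.
    by exists s0 => s /E0 ->.
  (* A search with clock s tries only the candidates below s, hence [m.+1]. *)
  exists (maxn m.+1 (maxn s1 s2)) => s.
  rewrite !geq_max => /and3P[le_ms le1 le2].
  by rewrite (@bounded_search_complete _ _ m) //; [apply: E1 | apply: E2].
Qed.

(** * The clocked program, uniformly in the index *)

Definition program f (cf : computable f) : code := projT1 (cid cf).

Lemma eval_program f (cf : computable f) n : eval (program cf) n (f n).
Proof. by rewrite /program; case: (cid cf). Qed.

(* The fixed components of the clocked program. The recursion for CPrec takes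
   inputs <<a, s>, <k, r>> with r the clocked value at k, the one for CMu inputs
   <<n, s>, <j, st>> with st the state of bounded_search; clock_mu_step receives
   the latter paired with the clocked value at the candidate j. *)
Definition guard n := if nfst n is _.+1 then nsnd n else 0.

Definition clock_pair n :=
  if nfst n is _.+1 then
    if nsnd n is _.+1 then (npair (nfst n).-1 (nsnd n).-1).+1 else 0
  else 0.

Definition clock_prec_acc n := nsnd (nsnd n).

Definition clock_prec_arg n :=
  npair (npair (nfst (nfst n)) (npair (nfst (nsnd n)) (nsnd (nsnd n)).-1))
        (nsnd (nfst n)).

Definition clock_prec_init n :=
  npair (npair (nfst (nfst n)) (nsnd n)) (nsnd (nfst n)).

Definition clock_mu_step n :=
  if nsnd (nsnd (nfst n)) is _.+1 then nsnd (nsnd (nfst n))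
  else if nsnd n is _.+1 then
    if (nsnd n).-1 is _.+1 then 0 else (nfst (nsnd (nfst n))).+2
  else 1.

Definition clock_mu_arg n :=
  npair (npair (nfst (nfst n)) (nfst (nsnd n))) (nsnd (nfst n)).

Definition clock_mu_init n := npair n (nsnd n).

Definition either n :=
  if nfst n is _.+1 then 0 else if nsnd n is _.+1 then 0 else 1.

Lemma computable_predn1 : computable predn.
Proof. exact: computable_predn computable_id. Qed.
Lemma computable_guard : computable guard.
Proof. by rewrite /guard; solve_computable. Qed.
Lemma computable_clock_pair : computable clock_pair.
Proof. by rewrite /clock_pair; solve_computable. Qed.
Lemma computable_clock_prec_acc : computable clock_prec_acc.
Proof. by rewrite /clock_prec_acc; solve_computable. Qed.
Lemma computable_clock_prec_arg : computable clock_prec_arg.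
Proof. by rewrite /clock_prec_arg; solve_computable. Qed.
Lemma computable_clock_prec_init : computable clock_prec_init.
Proof. by rewrite /clock_prec_init; solve_computable. Qed.
Lemma computable_clock_mu_step : computable clock_mu_step.
Proof. by rewrite /clock_mu_step; solve_computable. Qed.
Lemma computable_clock_mu_arg : computable clock_mu_arg.
Proof. by rewrite /clock_mu_arg; solve_computable. Qed.
Lemma computable_clock_mu_init : computable clock_mu_init.
Proof. by rewrite /clock_mu_init; solve_computable. Qed.
Lemma computable_either : computable either.
Proof. by rewrite /either; solve_computable. Qed.


(** Each clause combines translated subprograms with fixed components, so the translation becomes a
    course-of-values recursion on indices. After a failure the later subprogram still runs, on a
    junk input; this is harmless because translated programs are total, and [guard] discards the
    result. *)
Fixpoint clocked (c : code) : code :=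
  match c with
  | CZero => program (computable_const 1)
  | CSucc => CComp CSucc (CComp CSucc CFst)
  | CFst => CComp CSucc (CComp CFst CFst)
  | CSnd => CComp CSucc (CComp CSnd CFst)
  | CPair f g =>
      CComp (program computable_clock_pair) (CPair (clocked f) (clocked g))
  | CComp f g =>
      CComp (program computable_guard)
        (CPair (clocked g)
           (CComp (clocked f)
              (CPair (CComp (program computable_predn1) (clocked g)) CSnd)))
  | CPrec f g =>
      CComp
        (CPrec (clocked f)
           (CComp (program computable_guard)
              (CPair (program computable_clock_prec_acc)
                 (CComp (clocked g) (program computable_clock_prec_arg)))))
        (program computable_clock_prec_init)
  | CMu f =>
      CComp (program computable_predn1)
        (CComp
           (CPrec CZero
              (CComp (program computable_clock_mu_step)
                 (CPair (program computable_id)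
                    (CComp (clocked f) (program computable_clock_mu_arg)))))
           (program computable_clock_mu_init))
  end.

Lemma eval_CComp f g n a m : eval g n a -> eval f a m -> eval (CComp f g) n m.
Proof. by exists a. Qed.

Lemma eval_CPair f g n a b :
  eval f n a -> eval g n b -> eval (CPair f g) n (npair a b).
Proof. by exists a, b. Qed.

Lemma eval_program_eq f (cf : computable f) n m :
  f n = m -> eval (program cf) n m.
Proof. by move=> <-; exact: eval_program. Qed.

Lemma eval_CPrec f g a k h : eval f a (h 0) ->
  (forall i, eval g (npair a (npair i (h i))) (h i.+1)) ->
  eval (CPrec f g) (npair a k) (h k).
Proof.
move=> f0 gS /=; rewrite !npairE; elim: k => //= k IH.
by exists (h k).
Qed.

Lemma eval_clocked c n s : eval (clocked c) (npair n s) (clocked_eval c n s).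
Proof.
elim: c n s => [||||f IHf g IHg|f IHf g IHg|f IHf g IHg|f IHf] n s; cbn [clocked].
- exact: eval_program.
- by apply: eval_CComp => //; apply: eval_CComp => //=; rewrite !npairE.
- by apply: eval_CComp => //; apply: eval_CComp => //=; rewrite !npairE.
- by apply: eval_CComp => //; apply: eval_CComp => //=; rewrite !npairE.
- apply: (eval_CComp (eval_CPair (IHf _ _) (IHg _ _))).
  apply: eval_program_eq; rewrite /clock_pair !npairE /=.
  by case: (clocked_eval f n s) => // a; case: (clocked_eval g n s).
- have E : eval CSnd (npair n s) s by rewrite /= npairE.
  have Ep := eval_CComp (IHg n s) (eval_program computable_predn1 _).
  apply: (eval_CComp (eval_CPair (IHg _ _)
    (eval_CComp (eval_CPair Ep E) (IHf _ _)))).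
  apply: eval_program_eq; rewrite /guard !npairE /=.
  by case: (clocked_eval g n s).
- apply: (eval_CComp (eval_program _ _)).
  rewrite /clock_prec_init !npairE.
  (* The sequence of clocked values along the recursion, with 0 propagating once a stage has
     failed. *)
  pose h k := nat_rect (fun=> nat) (clocked_eval f (nfst n) s)
        (fun k r => if r is r'.+1
           then clocked_eval g (npair (nfst n) (npair k r')) s else 0) k.
  apply: (@eval_CPrec _ _ (npair (nfst n) s) (nsnd n) h) => [|i]; first exact: IHf.
  apply: (eval_CComp (eval_CPair (eval_program _ _)
    (eval_CComp (eval_program computable_clock_prec_arg _) (IHg _ _)))).
  apply: eval_program_eq.
  rewrite /guard /clock_prec_acc !npairE /h /=.
  by case: (nat_rect _ _ _ i).
- apply: (eval_CComp _ (eval_program _ _)).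
  apply: (eval_CComp (eval_program _ _)).
  rewrite /clock_mu_init !npairE.
  apply: (@eval_CPrec _ _ (npair n s) s
    (bounded_search (fun k => clocked_eval f (npair n k) s))) => // i.
  apply: (eval_CComp (eval_CPair (eval_program _ _)
    (eval_CComp (eval_program computable_clock_mu_arg _) (IHf _ _)))).
  apply: eval_program_eq.
  rewrite /clock_mu_step !npairE /=.
  case: (bounded_search _ i) => [|//].
  by case: (clocked_eval f _ s) => [|[]].
Qed.

Definition mkpair a b := 4 + (4 * npair a b).
Definition mkcomp a b := 4 + (4 * npair a b + 1).
Definition mkprec a b := 4 + (4 * npair a b + 2).
Definition mkmu a := 4 + (4 * a + 3).

Lemma computable_mkpair f g :
  computable f -> computable g -> computable (fun n => mkpair (f n) (g n)).
Proof. by rewrite /mkpair => cf cg; solve_arith. Qed.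

Lemma computable_mkcomp f g :
  computable f -> computable g -> computable (fun n => mkcomp (f n) (g n)).
Proof. by rewrite /mkcomp => cf cg; solve_arith. Qed.

Lemma computable_mkprec f g :
  computable f -> computable g -> computable (fun n => mkprec (f n) (g n)).
Proof. by rewrite /mkprec => cf cg; solve_arith. Qed.

Lemma computable_mkmu f : computable f -> computable (fun n => mkmu (f n)).
Proof. by rewrite /mkmu => cf; solve_arith. Qed.

Lemma computable_recall f g h : computable f -> computable g -> computable h ->
  computable (fun n => recall (f n) (g n) (h n)).
Proof. by rewrite /recall => cf cg ch; solve_arith. Qed.

Ltac index_step :=
  lazymatch goal with
  | |- computable (fun n => mkpair (@?f n) (@?g n)) =>
      apply: (@computable_mkpair f g)
  | |- computable (fun n => mkcomp (@?f n) (@?g n)) =>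
      apply: (@computable_mkcomp f g)
  | |- computable (fun n => mkprec (@?f n) (@?g n)) =>
      apply: (@computable_mkprec f g)
  | |- computable (fun n => mkmu (@?f n)) => apply: (@computable_mkmu f)
  | |- computable (fun n => recall (@?f n) (@?g n) (@?h n)) =>
      apply: (@computable_recall f g h)
  | _ => arith_step
  end.

Ltac solve_index := repeat first [assumption | index_step].

Definition decode (e : nat) : code := projT1 (cid (encode_surj e)).

Lemma decodeK : cancel decode encode.
Proof. by move=> e; rewrite /decode; case: (cid _). Qed.

Lemma encodeK : cancel encode decode.
Proof. by move=> c; apply: encode_inj; rewrite decodeK. Qed.

Definition clocked_index (e : nat) : nat := encode (clocked (decode e)).

(** The tests on e split off the basic programs 0 to 3. Beyond them, r is the constructor tag, with
    0, 1, 2, 3 for pairing, composition, recursion and search, and the translations of the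
    subprograms are looked up in the history. The literals 0 and 3 inside the clauses are the
    indices of [CZero] and [CSnd]. *)
Definition clocked_index_step (n : nat) : nat :=
  let e := nfst n in
  let q := (e - 4) %/ 4 in
  let r := (e - 4) %% 4 in
  let rec k := recall (nsnd n) e k in
  let f := rec (nfst q) in
  let g := rec (nsnd q) in
  if e is _.+1 then if e.-1 is _.+1 then if e.-1.-1 is _.+1 then
  if e.-1.-1.-1 is _.+1 then
    if r is _.+1 then if r.-1 is _.+1 then if r.-1.-1 is _.+1 then
      mkcomp (encode (program computable_predn1))
        (mkcomp
           (mkprec 0
              (mkcomp (encode (program computable_clock_mu_step))
                 (mkpair (encode (program computable_id))
                    (mkcomp (rec q) (encode (program computable_clock_mu_arg))))))
           (encode (program computable_clock_mu_init)))
    else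
      mkcomp
        (mkprec f
           (mkcomp (encode (program computable_guard))
              (mkpair (encode (program computable_clock_prec_acc))
                 (mkcomp g (encode (program computable_clock_prec_arg))))))
        (encode (program computable_clock_prec_init))
    else
      mkcomp (encode (program computable_guard))
        (mkpair g
           (mkcomp f (mkpair (mkcomp (encode (program computable_predn1)) g) 3)))
    else mkcomp (encode (program computable_clock_pair)) (mkpair f g)
  else encode (clocked CSnd)
  else encode (clocked CFst)
  else encode (clocked CSucc)
  else encode (clocked CZero).

Lemma computable_clocked_index_step : computable clocked_index_step.
Proof. by rewrite /clocked_index_step /=; solve_index. Qed.

Lemma clocked_index_encode c : clocked_index (encode c) = encode (clocked c).
Proof. by rewrite /clocked_index encodeK. Qed.

Lemma clocked_indexE e :
  clocked_index e = clocked_index_step (npair e (history clocked_index e)).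
Proof.
rewrite /clocked_index_step !npairE.
set R := recall (history clocked_index e) e.
have RE k : k < e -> R k = clocked_index k by exact: recall_history.
(* Only the values of [R] below e matter from here on, so its definition is dropped. *)
move: R RE => R; rewrite -(decodeK e) clocked_index_encode.
move: (decode e) => c RE.
have ge_q q r : 4 + (4 * q + r) - 4 = 4 * q + r by lia.
have div_q q r : r < 4 -> (4 * q + r) %/ 4 = q by lia.
have mod_q q r : r < 4 -> (4 * q + r) %% 4 = r by lia.
case: c RE => [||||f g|f g|f g|f] //; rewrite [encode _]/= => RE.
(* The tag 0 of pairing is invisible in [encode] and is restored first. *)
- rewrite -[X in 4 + X]addn0 ge_q div_q // mod_q // !npairE.
  (* The pairing dominates its components, so subprograms have smaller indices and [RE] applies to
     them. *)
  have le_fg := npair_ge (encode f) (encode g).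
  by rewrite !RE ?clocked_index_encode //; lia.
- rewrite ge_q div_q // mod_q // !npairE.
  have le_fg := npair_ge (encode f) (encode g).
  by rewrite !RE ?clocked_index_encode //; lia.
- rewrite ge_q div_q // mod_q // !npairE.
  have le_fg := npair_ge (encode f) (encode g).
  by rewrite !RE ?clocked_index_encode //; lia.
- rewrite ge_q div_q // mod_q //.
  by rewrite (RE (encode f)) ?clocked_index_encode //; lia.
Qed.

Lemma computable_clocked_index : computable clocked_index.
Proof.
exact: computable_course_of_values computable_clocked_index_step clocked_indexE.
Qed.

(** * Effective closure properties of c.e. sets *)

Lemma W_encode c : W (encode c) = [set x | exists y, eval c x y].
Proof.
apply/seteqP; split=> x /=; last by exists c.
by move=> [d [/encode_inj-> ?]].
Qed.

Lemma mkpair_decode a b : mkpair a b = encode (CPair (decode a) (decode b)).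
Proof. by rewrite /= !decodeK. Qed.

Lemma mkcomp_decode a b : mkcomp a b = encode (CComp (decode a) (decode b)).
Proof. by rewrite /= !decodeK. Qed.

Lemma W_decode e : W e = [set x | exists y, eval (decode e) x y].
Proof. by rewrite -{1}(decodeK e) W_encode. Qed.

(** The index function provided here serves as the reduction in both directions of the theorem. *)
Definition uniformly_ce (A : nat -> set nat) : Prop :=
  exists2 f, computable f & forall e, W (f e) = A e.

Lemma uniformly_ce_preimage h : computable h ->
  uniformly_ce (fun e => h @^-1` W e).
Proof.
move=> ch; exists (fun e => mkcomp e (encode (program ch))).
  by solve_index.
move=> e; rewrite mkcomp_decode encodeK W_encode W_decode.
apply/seteqP; split=> x [y] /=.
  by move=> [a /(eval_functional (eval_program ch x)) <- ?]; exists y.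
by exists y, (h x) => //; exact: eval_program.
Qed.

Lemma uniformly_ce_setI A B : uniformly_ce A -> uniformly_ce B ->
  uniformly_ce (fun e => A e `&` B e).
Proof.
move=> [f cf fE] [g cg gE]; exists (fun e => mkpair (f e) (g e)); first by solve_index.
move=> e; rewrite -fE -gE mkpair_decode W_encode !W_decode.
apply/seteqP; split=> x /=.
  by move=> [y [a [b [fa gb _]]]]; split; [exists a | exists b].
by move=> [[a fa] [b gb]]; exists (npair a b), a, b.
Qed.

(** Searches for a clock at which one of the two programs has halted. The clocked programs are
    total, so a divergent one cannot block the search. *)
Lemma uniformly_ce_setU A B : uniformly_ce A -> uniformly_ce B ->
  uniformly_ce (fun e => A e `|` B e).
Proof.
move=> [f cf fE] [g cg gE].
have c_clocked h : computable h -> computable (fun e => clocked_index (h e)).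
  exact: computable_comp computable_clocked_index.
exists (fun e => mkmu (mkcomp (encode (program computable_either))
  (mkpair (clocked_index (f e)) (clocked_index (g e))))).
  by have := c_clocked _ cf; have := c_clocked _ cg => ? ?; solve_index.
move=> e; rewrite -fE -gE -(decodeK (f e)) -(decodeK (g e)) !clocked_index_encode.
move: (decode (f e)) (decode (g e)) => c d.
rewrite (_ : mkmu _ = encode (CMu (CComp (program computable_either)
  (CPair (clocked c) (clocked d))))) // !W_encode.
have evalE x s : eval (CComp (program computable_either)
    (CPair (clocked c) (clocked d))) (npair x s)
    (either (npair (clocked_eval c x s) (clocked_eval d x s))).
  apply: eval_CComp (eval_program _ _).
  by apply: eval_CPair; exact: eval_clocked.
apply/seteqP; split=> x.
  move=> [s [/(eval_functional (evalE x s)) + _]].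
  rewrite /either !npairE.
  case Ec: (clocked_eval c x s) => [|m]; last first.
    by left; exists m; exact: clocked_eval_sound Ec.
  case Ed: (clocked_eval d x s) => [|m] // _.
  by right; exists m; exact: clocked_eval_sound Ed.
move=> cdx.
(* [CMu] requires positive values at all earlier arguments, so the least such clock is taken. *)
pose halted s :=
  either (npair (clocked_eval c x s) (clocked_eval d x s)) == 0.
have ex_halted : exists s, halted s.
  rewrite /halted /either.
  by case: cdx => [[m /clocked_eval_complete[s E]]|[m /clocked_eval_complete[s E]]];
    exists s; rewrite !npairE E //; case: clocked_eval.
have [s /eqP hs min_s] := ex_minnP ex_halted.
exists s; split; first by rewrite -hs; exact: evalE.
move=> k lt_ks; have := evalE x k.
have : ~~ halted k by apply/negP => /min_s; rewrite leqNgt lt_ks.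
by rewrite /halted; case: (either _) => // y _ ?; exists y.
Qed.

Lemma uniformly_ce_bigcap (T : eqType) (s : seq T) (A : T -> nat -> set nat) :
  (forall t, t \in s -> uniformly_ce (A t)) ->
  uniformly_ce (fun e => [set x | forall t, t \in s -> A t e x]).
Proof.
elim: s => [_|t s IH cA].
  (* The empty intersection is everything, and [CZero] halts everywhere. *)
  exists (fun=> encode CZero); first exact: computable_const.
  by move=> e; rewrite W_encode; apply/seteqP; split=> x //= _; exists 0.
have [||f cf fE] := @uniformly_ce_setI (A t)
    (fun e => [set x | forall t, t \in s -> A t e x]).
- by apply: cA; rewrite mem_head.
- by apply: IH => u us; apply: cA; rewrite inE us orbT.
exists f => // e; rewrite fE; apply/seteqP; split=> x /=.
  by move=> [Ax Asx] u; rewrite inE => /orP[/eqP->|/Asx].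
by move=> Ax; split=> [|u us]; apply: Ax; rewrite inE ?eqxx ?us ?orbT.
Qed.

Lemma uniformly_ce_bigcup (T : eqType) (s : seq T) (A : T -> nat -> set nat) :
  (forall t, t \in s -> uniformly_ce (A t)) ->
  uniformly_ce (fun e => [set x | exists2 t, t \in s & A t e x]).
Proof.
elim: s => [_|t s IH cA].
  (* [CMu CSucc] halts nowhere, since a successor is never zero. *)
  exists (fun=> encode (CMu CSucc)); first exact: computable_const.
  by move=> e; rewrite W_encode; apply/seteqP; split=> x /= -[y] // [].
have [||f cf fE] := @uniformly_ce_setU (A t)
    (fun e => [set x | exists2 t, t \in s & A t e x]).
- by apply: cA; rewrite mem_head.
- by apply: IH => u us; apply: cA; rewrite inE us orbT.
exists f => // e; rewrite fE; apply/seteqP; split=> x /=.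
  move=> [Ax|[u us Ax]]; first by exists t; rewrite ?mem_head.
  by exists u; rewrite // inE us orbT.
move=> [u]; rewrite inE => /orP[/eqP->|us] Ax; first by left.
by right; exists u.
Qed.

(** * Actions with finitely many permutations *)

Lemma gactK (G : computable_subgroup_Sinf) g : gdom G g ->
  cancel (gact G g) (gact G (ginv G g)).
Proof. by move=> Gg x; rewrite -gactM ?gdom_inv // gmulV // gact1. Qed.

(** The group axioms give left inverses only; the other side follows by cancelling the inverse,
    which acts injectively. *)
Lemma gactVK (G : computable_subgroup_Sinf) g : gdom G g ->
  cancel (gact G (ginv G g)) (gact G g).
Proof.
move=> Gg x; apply: (can_inj (gactK (gdom_inv Gg))).
exact: gactK.
Qed.

(** The list is a finite constant built into the programs, so it may be chosen non-effectively. *)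
Definition represents_actions (G : computable_subgroup_Sinf) (s : seq nat) :
    Prop :=
  (forall g, g \in s -> gdom G g) /\
  (forall g, gdom G g -> exists2 h, h \in s & gact G h = gact G g).

Lemma finite_image_representatives (T : eqType) (U : choiceType) (f : T -> U)
    (D : set T) : finite_set (f @` D) ->
  exists s : seq T, (forall x, x \in s -> D x) /\
                    (forall x, D x -> exists2 y, y \in s & f y = f x).
Proof.
move=> /finite_seqP[l lE].
have sub_l u : u \in l -> exists2 x, D x & f x = u.
  by move=> ul; have : [set` l] u by []; rewrite -lE.
have [s [sD sl]] : exists s : seq T, (forall x, x \in s -> D x) /\ map f s = l.
  elim: l sub_l {lE} => [|u l IH] sub_l; first by exists [::].
  have [|s [sD sl]] := IH; first by move=> v vl; apply: sub_l; rewrite inE vl orbT.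
  have [x Dx fx] := sub_l u (mem_head _ _).
  exists (x :: s); split=> [y|]; last by rewrite /= fx sl.
  by rewrite inE => /orP[/eqP->|/sD].
exists s; split=> // x Dx.
have : [set` l] (f x) by rewrite -lE; exists x.
by rewrite -sl /= => /mapP[y ys ->]; exists y.
Qed.

Lemma ex_represents_actions (G : computable_subgroup_Sinf) :
  finitely_many_actions G -> exists s, represents_actions G s.
Proof. exact: finite_image_representatives. Qed.

Lemma computable_gact (G : computable_subgroup_Sinf) g f :
  computable f -> computable (fun x => gact G g (f x)).
Proof. by apply: computable2_app (gact_computable G) _; exact: computable_const. Qed.

(** * Reducing the orbit relation to equality *)

(** Every number reads as a tuple of any length, so [carried] needs no test for valid codes. *)
Definition coord (j x : nat) : nat := nfst (iter j nsnd x).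

Lemma coord_foldr l j : j < size l -> coord j (foldr npair 0 l) = nth 0 l j.
Proof.
rewrite /coord; elim: l j => //= a l IH [|j] lt_j; first by rewrite /= nfst_npair.
by rewrite iterSr nsnd_npair IH.
Qed.

(* x codes a tuple with one entry for each permutation in s; some permutation in
   s carries all entries into A. *)
Definition carried (G : computable_subgroup_Sinf) (s : seq nat)
    (A : set nat) : set nat :=
  [set x | exists2 g, g \in s &
             forall j, j \in iota 0 (size s) -> A (gact G g (coord j x))].

(** A finite union, over the permutations, of finite intersections, over the entries, of computable
    preimages. *)
Lemma uniformly_ce_carried G s : uniformly_ce (fun e => carried G s (W e)).
Proof.
apply: (uniformly_ce_bigcup (A := fun g e => [set x | forall j,
  j \in iota 0 (size s) -> W e (gact G g (coord j x))])) => g _.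
apply: (uniformly_ce_bigcap (A := fun j e => [set x | W e (gact G g (coord j x))])) => j _.
apply: uniformly_ce_preimage; apply: computable_gact.
by rewrite /coord; solve_arith.
Qed.

Lemma carried_sub_image G s A B g : represents_actions G s -> gdom G g ->
  (forall a, A a -> B (gact G g a)) -> carried G s A `<=` carried G s B.
Proof.
move=> [sG Gs] Gg AB x [h hs Ah].
have [k ks kE] := Gs _ (gdom_mul Gg (sG h hs)).
by exists k => // j /Ah /AB; rewrite kE gactM // sG.
Qed.

(* If no permutation maps A into B, take as entries one witness in A for each
   permutation: this tuple lies in carried A but not in carried B. *)
Lemma carried_sub_exists G s A B : represents_actions G s ->
  carried G s A `<=` carried G s B ->
  exists2 g, gdom G g & forall a, A a -> B (gact G g a).
Proof.
move=> [sG Gs] sub_AB; apply: contrapT => noAB.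
(* Membership in s is put under the quantifier so that [choice] gives a total function; outside s
   any value will do. *)
have wit g : exists a, g \in s -> A a /\ ~ B (gact G g a).
  apply: contrapT => Hg; apply: noAB; exists g.
    by apply: sG; apply: contrapT => gs; apply: Hg; exists 0.
  by move=> a Aa; apply: contrapT => nB; apply: Hg; exists a.
have [w wE] := choice wit.
have coordE j : j < size s -> coord j (foldr npair 0 (map w s)) = w (nth 0 s j).
  by move=> js; rewrite coord_foldr ?size_map // (nth_map 0).
have [|g gs Bg] := sub_AB (foldr npair 0 (map w s)).
  have [h hs hE] := Gs _ (gdom_one G).
  exists h => // j; rewrite mem_iota /= => js.
  by rewrite hE gact1 coordE //; apply: (wE _ _).1; exact: mem_nth.
(* Diagonal step: the entry at the position of g is the witness that g moves out of B. *)
have := Bg (index g s); rewrite mem_iota /= index_mem coordE ?index_mem // nth_index //.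
by move=> /(_ gs); apply: (wE g gs).2.
Qed.

(** Pigeonhole: the exponents 0 to [size s] outnumber the representatives, so two powers share
    one. *)
Lemma gact_iter_repeat G s g : represents_actions G s -> gdom G g ->
  exists i d, iter (i + d.+1) (gact G g) =1 iter i (gact G g).
Proof.
move=> [sG Gs] Gg.
have powE n : exists h, h \in s /\ gact G h =1 iter n (gact G g).
  elim: n => [|n [h [hs hE]]].
    by have [h hs hE] := Gs _ (gdom_one G); exists h; split=> // x; rewrite hE gact1.
  have Gh := sG h hs; have [k ks kE] := Gs _ (gdom_mul Gg Gh).
  by exists k; split=> // x; rewrite kE gactM // hE.
have [r rE] := choice powE.
have r_lt n : index (r n) s < size s by rewrite index_mem (rE n).1.
pose F (i : 'I_(size s).+1) := Ordinal (r_lt i).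
have nF : ~~ injectiveb F.
  by apply/injectiveP => /leq_card; rewrite !card_ord ltnn.
have [i [j [ne_ij Fij]]] : exists i j : nat, i != j /\ r i = r j.
  have [i [j ne_ij [Fij]]] := injectivePn _ nF.
  exists i, j; split=> //; rewrite -(nth_index 0 (rE i).1) Fij.
  by rewrite nth_index ?(rE j).1.
wlog lt_ij : i j ne_ij Fij / i < j.
  move=> H; have [lt|gt|eq] := ltngtP i j; first exact: (H i j).
    by apply: (H j i) => //; rewrite eq_sym.
  by rewrite eq eqxx in ne_ij.
exists i, (j - i).-1 => x.
have -> : i + (j - i).-1.+1 = j by lia.
by rewrite -(rE i).2 -(rE j).2 Fij.
Qed.

Lemma carried_eq_exists G s A B : represents_actions G s ->
  carried G s A = carried G s B -> exists2 g, gdom G g & A = gact G g @` B.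
Proof.
move=> rep eqAB.
have [|g Gg gAB] := @carried_sub_exists G s A B rep; first by rewrite eqAB.
have [|h Gh hBA] := @carried_sub_exists G s B A rep; first by rewrite eqAB.
exists h => //; apply/seteqP; split=> [a Aa|_ [b /hBA ? <-]] //.
have Gk := gdom_mul Gh Gg; set k := gmul G h g in Gk.
have kA b : A b -> A (gact G k b) by move=> /gAB /hBA; rewrite /k gactM.
have [i [d /(_ a)]] := gact_iter_repeat rep Gk.
(* Cancelling the i-fold iterate leaves a = k (k^d a) = h (g (k^d a)), and g (k^d a) lies in B
   because k^d a lies in A. *)
have iter_inj : injective (iter i (gact G k)).
  by elim: i => //= i IH x y /(can_inj (gactK Gk)) /IH.
rewrite iterD => /iter_inj /= da.
have Ad : A (iter d (gact G k) a) by elim: d {da} => //= d /kA.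
by exists (gact G g (iter d (gact G k) a)); [apply: gAB | rewrite -gactM].
Qed.

Lemma R_ce_reducible G s : represents_actions G s -> creducible (R_ce G) eq_ce.
Proof.
move=> rep; have [f cf fE] := uniformly_ce_carried G s.
exists f => // i j; rewrite /R_ce /eq_ce !fE; split; last exact: carried_eq_exists.
move=> [g Gg ->]; apply/seteqP; split; last first.
  by apply: (carried_sub_image (g := g)) => // a; exists a.
apply: (carried_sub_image (g := ginv G g)) => //; first exact: gdom_inv.
by move=> _ [a ? <-]; rewrite gactK.
Qed.

(** * Reducing equality to the orbit relation *)

(** Starting the fold at x is harmless, since x lies in its own orbit. *)
Definition orbit_min (G : computable_subgroup_Sinf) (s : seq nat) (x : nat) : nat :=
  foldr (fun g => minn (gact G g x)) x s.

Lemma computable_orbit_min G s : computable (orbit_min G s).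
Proof.
rewrite /orbit_min; elim: s => [|g s IH] /=; first exact: computable_id.
by apply: computable_minn => //; apply: computable_gact; exact: computable_id.
Qed.

Lemma orbit_min_le G s x g : represents_actions G s -> gdom G g ->
  orbit_min G s x <= gact G g x.
Proof.
move=> [_ Gs] /Gs[h hs <-]; rewrite /orbit_min {Gs}.
elim: s hs => //= k s IH; rewrite inE geq_min => /orP[/eqP->|/IH->].
  by rewrite leqnn.
by rewrite orbT.
Qed.

Lemma orbit_min_exists G s x : represents_actions G s ->
  exists2 g, gdom G g & orbit_min G s x = gact G g x.
Proof.
move=> [sG _]; rewrite /orbit_min; elim: s sG => [|g s IH] sG /=.
  by exists (gone G); [exact: gdom_one | rewrite gact1].
have [|h Gh ->] := IH; first by move=> k ks; apply: sG; rewrite inE ks orbT.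
case: leqP => _; first by exists g; rewrite // sG // mem_head.
by exists h.
Qed.

Lemma orbit_min_gact G s x g : represents_actions G s -> gdom G g ->
  orbit_min G s (gact G g x) = orbit_min G s x.
Proof.
move=> rep Gg; apply/eqP; rewrite eqn_leq; apply/andP; split.
  have [h Gh ->] := orbit_min_exists x rep.
  rewrite -{2}(gactK Gg x) -gactM ?gdom_inv //.
  by apply: orbit_min_le => //; apply: gdom_mul; rewrite ?gdom_inv.
have [h Gh ->] := orbit_min_exists (gact G g x) rep.
by rewrite -gactM //; apply: orbit_min_le => //; exact: gdom_mul.
Qed.

Lemma orbit_min_id G s x : represents_actions G s ->
  orbit_min G s (orbit_min G s x) = orbit_min G s x.
Proof.
by move=> rep; have [g Gg E] := orbit_min_exists x rep; rewrite {1}E orbit_min_gact.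
Qed.

Lemma orbit_min_unbounded G s N : represents_actions G s ->
  exists x, N <= orbit_min G s x.
Proof.
move=> rep; have [sG Gs] := rep.
(* This x exceeds every image of a number below N. A minimum below N would be carried back to x by
   an inverse, giving x < x. *)
pose x := (\max_(g <- s) \max_(y < N) gact G g y).+1.
exists x; rewrite leqNgt; apply/negP => lt_xN.
have [g Gg gE] := orbit_min_exists x rep.
have [h hs hE] := Gs _ (gdom_inv Gg).
have : gact G h (orbit_min G s x) < x.
  rewrite ltnS; apply: leq_trans (leq_bigmax_seq _ hs isT).
  exact: (leq_bigmax (Ordinal lt_xN)).
by rewrite hE gE gactK // ltnn.
Qed.

(** Counts the orbit minima below k: as [orbit_min G s i] is at most i, the truncated difference
    vanishes exactly when i is the minimum of its orbit. *)
Fixpoint count_orbits G s (k : nat) : nat :=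
  if k is i.+1 then
    if i - orbit_min G s i is _.+1 then count_orbits G s i
    else (count_orbits G s i).+1
  else 0.

Definition orbit_number G s x := count_orbits G s (orbit_min G s x).

Lemma computable_orbit_number G s : computable (orbit_number G s).
Proof.
apply: (@computable_comp (count_orbits G s)); last exact: computable_orbit_min.
apply: (@computable_prec1 _ 0 (fun n =>
  if nfst n - orbit_min G s (nfst n) is _.+1 then nsnd n else (nsnd n).+1)) => //.
  have := computable_comp (computable_orbit_min G s) (computable_nfst computable_id).
  by move=> ?; solve_arith.
by move=> k; rewrite !npairE.
Qed.

Lemma count_orbits_unbounded G s n : represents_actions G s ->
  exists k, n <= count_orbits G s k.
Proof.
move=> rep; elim: n => [|n [k le_nk]]; first by exists 0.
have [x le_kx] := orbit_min_unbounded k rep.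
exists (orbit_min G s x).+1; rewrite /= orbit_min_id // subnn ltnS.
apply: leq_trans le_nk _.
(* Monotonicity of [count_orbits] from k upwards. *)
elim: (orbit_min G s x) le_kx => [|m IH]; first by rewrite leqn0 => /eqP->.
rewrite leq_eqVlt => /orP[/eqP->//|/IH le_km]; apply: leq_trans le_km _ => /=.
by case: (m - _).
Qed.

(** At the least k whose count exceeds n, the predecessor i of k has just been counted; so i is an
    orbit minimum with exactly n minima below it. *)
Lemma orbit_number_surj G s n : represents_actions G s ->
  exists x, orbit_number G s x = n.
Proof.
move=> rep; have [k lt_nk min_k] := ex_minnP (count_orbits_unbounded n.+1 rep).
case: k lt_nk min_k => // i /=.
case E: (i - orbit_min G s i) => [|d] lt_ni min_i; last first.
  by have := min_i _ lt_ni; rewrite ltnn.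
have i_min : orbit_min G s i = i.
  have := orbit_min_le i rep (gdom_one G); rewrite gact1; lia.
exists i; rewrite /orbit_number i_min; apply/eqP.
rewrite eqn_leq -(ltnS n) lt_ni andbT.
by rewrite leqNgt; apply/negP => /min_i; rewrite ltnn.
Qed.

Lemma eq_ce_reducible G s : represents_actions G s -> creducible eq_ce (R_ce G).
Proof.
move=> rep.
have [f cf fE] := uniformly_ce_preimage (computable_orbit_number G s).
exists f => // i j; rewrite /eq_ce /R_ce !fE; split=> [->|[g Gg WE]].
  exists (gone G); first exact: gdom_one.
  apply/seteqP; split=> [x Wx|_ [x Wx <-]]; last by rewrite gact1.
  by exists x; rewrite ?gact1.
have invE x : orbit_number G s (gact G g x) = orbit_number G s x.
  by rewrite /orbit_number orbit_min_gact.
(* The preimage is a union of orbits, so g maps it onto itself. *)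
have {}WE : orbit_number G s @^-1` W i = orbit_number G s @^-1` W j.
  rewrite WE; apply/seteqP; split=> [_ [x Wx <-]|x Wx]; first by rewrite /= invE.
  by exists (gact G (ginv G g) x); rewrite ?gactVK //= -invE gactVK.
apply/seteqP; split=> n; have [x <-] := orbit_number_surj n rep => Wx.
  by have : (orbit_number G s @^-1` W j) x by rewrite -WE.
by have : (orbit_number G s @^-1` W i) x by rewrite WE.
Qed.

Theorem theorem3p5 (G : computable_subgroup_Sinf) :
  finitely_many_actions G -> cequivalent (R_ce G) eq_ce.
Proof.
move=> /ex_represents_actions[s rep].
by split; [exact: R_ce_reducible rep | exact: eq_ce_reducible rep].
Qed.
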